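(* Let $G=(V,E)$ and the algorithm be as described in the context, with $n=|V|$ and $m=|E|$. Under the distributed adversarial daemon, every execution starting from an arbitrary configuration reaches a stable configuration after at most $3n+2m$ steps.
   Context: Let $G=(V,E)$ be a finite simple undirected graph; each node is a process and $N(i)$ denotes the set of neighbours of $i$. Each process has an identifier from a totally ordered set; identifiers of any two distinct processes at distance at most $2$ are distinct, and comparisons such as $j>i$ between processes are comparisons of their identifiers. Each process $i$ holds variables $m_i\in\{\text{true},\text{false}\}$ and $p_i\in\{null\}\cup N(i)$; a configuration is an assignment of values to all these variables. Define the predicate $PRmarried(i)\equiv \exists j\in N(i): (p_i=j \text{ and } p_j=i)$. The algorithm consists of the following four guarded rules for each process $i$ (a rule is enabled at $i$ if its guard holds; at most one rule is enabled at a process at any time): Update: if $m_i\neq PRmarried(i)$ then $m_i:=PRmarried(i)$. Marriage: if $m_i=PRmarried(i)$ and $p_i=null$ and there is $j\in N(i)$ with $p_j=i$, then $p_i:=j$ (for such a $j$). Seduction: if $m_i=PRmarried(i)$ and $p_i=null$ and $p_k\neq i$ for all $k\in N(i)$ and there is $j\in N(i)$ with $p_j=null$, $j>i$ and $m_j=\text{false}$, then $p_i:=\max\{j\in N(i): p_j=null,\ j>i,\ m_j=\text{false}\}$. Abandonment: if $m_i=PRmarried(i)$ and $p_i=j\neq null$ and $p_j\neq i$ and ($m_j=\text{true}$ or $j\le i$), then $p_i:=null$. A process is eligible if some rule is enabled at it; a configuration is stable if no process is eligible. Under the distributed adversarial daemon, a step from a configuration $C$ consists of an arbitrary nonempty subset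 of the processes eligible in $C$ each executing its enabled rule, all guards and assignments being evaluated in $C$ (simultaneous execution); an execution is a maximal sequence of configurations, starting from an arbitrary configuration, each obtained from the previous one by a step. The execution of a rule by a process is called a move. *)

(* Defs.v *)
From mathcomp Require Import all_boot all_order.

Set Implicit Arguments.
Unset Strict Implicit.
Unset Printing Implicit Defensive.

Section Graph.
Variables (V : finType) (adj : rel V).

Definition simple_graph : Prop := symmetric adj /\ irreflexive adj.

Definition edges : {set {set V}} :=
  [set A | [exists i, exists j, adj i j && (A == [set i; j])]].

Definition dist_le2 (i j : V) : bool :=
  [|| i == j, adj i j | [exists k, adj i k && adj k j]].

End Graph.

(* [pvar c i = None] encodes p_i = null. *)
Record config (V : finType) (adj : rel V) := Config {
  mvar : V -> bool;
  pvar : V -> option V;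
  pvar_adj : forall i j, pvar i = Some j -> adj i j
}.

Section Algorithm.
Variables (V : finType) (adj : rel V).
Variables (d : Order.disp_t) (I : orderType d) (ident : V -> I).
Local Notation config := (config adj).

Definition locally_distinct : Prop :=
  forall i j, i != j -> dist_le2 adj i j -> ident i != ident j.

Definition PRmarried (c : config) (i : V) : bool :=
  [exists j, [&& adj i j, pvar c i == Some j & pvar c j == Some i]].

Definition update_guard (c : config) (i : V) : bool :=
  mvar c i != PRmarried c i.

Definition marriage_cand (c : config) (i j : V) : bool :=
  adj i j && (pvar c j == Some i).

Definition marriage_guard (c : config) (i : V) : bool :=
  [&& mvar c i == PRmarried c i, pvar c i == None
    & [exists j, marriage_cand c i j]].

Definition seduction_cand (c : config) (i j : V) : bool :=
  [&& adj i j, pvar c j == None, (ident i < ident j)%O & mvar c j == false].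

Definition seduction_guard (c : config) (i : V) : bool :=
  [&& mvar c i == PRmarried c i, pvar c i == None,
      [forall k, adj i k ==> (pvar c k != Some i)]
    & [exists j, seduction_cand c i j]].

Definition abandonment_guard (c : config) (i : V) : bool :=
  (mvar c i == PRmarried c i) &&
  (if pvar c i is Some j
   then (pvar c j != Some i) && (mvar c j || (ident j <= ident i)%O)
   else false).

Definition eligible (c : config) (i : V) : bool :=
  [|| update_guard c i, marriage_guard c i,
      seduction_guard c i | abandonment_guard c i].

Definition stable (c : config) : bool := [forall i, ~~ eligible c i].

(* [move c i b q]: in [c], process [i] may execute an enabled rule that leaves
   it with m_i = b and p_i = q. Marriage is nondeterministic in the choice
   of j. *)
Inductive move (c : config) (i : V) : bool -> option V -> Prop :=
| MoveUpdate :
    update_guard c i -> move c i (PRmarried c i) (pvar c i)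
| MoveMarriage j :
    marriage_guard c i -> marriage_cand c i j ->
    move c i (mvar c i) (Some j)
| MoveSeduction j :
    seduction_guard c i -> seduction_cand c i j ->
    (forall k, seduction_cand c i k -> (ident k <= ident j)%O) ->
    move c i (mvar c i) (Some j)
| MoveAbandonment :
    abandonment_guard c i -> move c i (mvar c i) None.

Definition step (c c' : config) : Prop :=
  exists S : {set V},
    [/\ S != set0,
        forall i, i \in S -> eligible c i,
        forall i, i \in S -> move c i (mvar c' i) (pvar c' i)
      & forall i, i \notin S -> mvar c' i = mvar c i /\ pvar c' i = pvar c i].

(* A finite or infinite nonempty sequence of configurations: [x k = None] means
   that the sequence has at most k terms. The [None] branch of the last clause
   is maximality: the sequence ends only where no step is possible. *)
Definition execution (x : nat -> option config) : Prop :=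
  [/\ x 0 <> None,
      forall k, x k = None -> x k.+1 = None
    & forall k c, x k = Some c ->
        match x k.+1 with
        | Some c' => step c c'
        | None => forall c', ~ step c c'
        end].

End Algorithm.

(* Main.v *)
Require Import Defs.
From mathcomp Require Import all_boot all_order.

(** Every step strictly decreases a potential that only depends on the
    configuration. Marriages are permanent, so a process performs at most two
    Update moves (true -> false -> true). On an edge [i < j], once [i] has pointed
    to [j] after the start, it abandons [j] only if [j] is really married
    elsewhere, and then never points to [j] again; and if [j] points to [i], either
    the pointer was present at the start or it completes a marriage. Hence each
    edge is responsible for at most two pointer moves, plus one for each pointer
    along it in the initial configuration, of which there are at most [n]. *)

Import Order.TTheory.

Set Implicit Arguments.
Unset Strict Implicit.
Unset Printing Implicit Defensive.

Lemma ltn_sum_D1 (T : finType) (P : pred T) (E F : T -> nat) x :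
  P x -> (forall y, P y -> E y <= F y) -> E x < F x ->
  \sum_(y | P y) E y < \sum_(y | P y) F y.
Proof.
move=> Px leEF ltEF; rewrite (bigD1 x) // [ltnRHS](bigD1 x) //= -addSn.
by rewrite leq_add // leq_sum // => y /andP[/leEF].
Qed.

Section Potential.
Variables (V : finType) (adj : rel V).
Variables (d : Order.disp_t) (I : orderType d) (ident : V -> I).
Hypotheses (adjS : symmetric adj) (adjI : irreflexive adj).
Hypothesis ident_distinct : locally_distinct adj ident.

Local Notation config := (config adj).

Implicit Types (c : config) (i j : V).

(** * Marriages, the potential and its upper bound *)

Lemma PRmarriedP c i :
  reflect (exists2 j, pvar c i = Some j & pvar c j = Some i) (PRmarried c i).
Proof.
apply: (iffP existsP) => [[j /and3P[_ /eqP pi /eqP pj]]|[j pi pj]]; exists j => //.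
by rewrite (pvar_adj pi) pi pj !eqxx.
Qed.

Lemma PRmarried_None c i : pvar c i = None -> PRmarried c i = false.
Proof. by move=> pi; apply/PRmarriedP => -[j]; rewrite pi. Qed.

Lemma PRmarried_Some c i j :
  pvar c i = Some j -> PRmarried c i = (pvar c j == Some i).
Proof.
move=> pi; apply/PRmarriedP/eqP => [[k]|pj]; last by exists j.
by rewrite pi => -[<-].
Qed.

(** Bounds the Update moves still ahead: a wrong [true] may be reset and later set again, while a
    [true] backed by a marriage is final. *)
Definition update_pot c i : nat :=
  if mvar c i then (if PRmarried c i then 0 else 2) else 1.

Definition points c i j : bool := pvar c i == Some j.

(* For [ident i < ident j], a bound on the number of pointer moves that can still
   occur along the edge. *)
Definition edge_pot c i j : nat :=
  if points c i j then
    if points c j i then 0 else if mvar c j && ~~ PRmarried c j then 3 else 1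
  else if points c j i then 3
  else if mvar c j && PRmarried c j then 0 else 2.

Definition arc (e : V * V) : bool := adj e.1 e.2 && (ident e.1 < ident e.2)%O.

Definition potential c : nat :=
  \sum_i update_pot c i + \sum_(e | arc e) edge_pot c e.1 e.2.

Lemma adj_ident_neq i j : adj i j -> ident i != ident j.
Proof.
move=> ij; apply: ident_distinct; last by rewrite /dist_le2 ij orbT.
by apply: contraTneq ij => ->; rewrite adjI.
Qed.

(** Orientation by identifier recovers the ordered pair from its set of endpoints, so arcs inject
    into edges. *)
Lemma card_arc : #|[pred e | arc e]| <= #|edges adj|.
Proof.
have inj : {in [pred e | arc e] &, injective (fun e : V * V => [set e.1; e.2])}.
  move=> [i j] [k l] /andP[/= _ ltij] /andP[/= _ ltkl] /= eqs.
  have := set21 i j; have := set22 i j; rewrite eqs !inE.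
  case/orP=> /eqP ej /orP[]/eqP ei; move: ltij; rewrite ei ej ?ltxx //.
  by move/(lt_trans ltkl); rewrite ltxx.
rewrite -(card_in_image inj); apply/subset_leq_card/subsetP => A.
case/imageP=> -[i j] /andP[/= ij _] ->; rewrite inE.
by apply/existsP; exists i; apply/existsP; exists j; rewrite ij /=.
Qed.

Lemma sum_points c i : \sum_j points c i j <= 1.
Proof.
rewrite /points; case: (pvar c i) => [k|]; last by rewrite big1.
rewrite (bigD1 k) //= eqxx big1 // => j /negbTE njk.
by apply/eqP; rewrite eqb0; apply/eqP => -[kj]; rewrite kj eqxx in njk.
Qed.

(* An edge is an arc in only one direction, so each pointer is counted once. *)
Lemma sum_arc_points c :
  \sum_(e | arc e) (points c e.1 e.2 + points c e.2 e.1) <= #|V|.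
Proof.
rewrite big_mkcond -(pair_bigA _ (fun i j => if arc (i, j)
  then (points c i j + points c j i)%N else 0)) /=.
under eq_bigr do under eq_bigr do
  rewrite -[if _ then _ else _]mulnbl mulnDr.
under eq_bigr do rewrite big_split.
(* Exchanging the second sum weights each pointer from [i] to [j] by [arc (i, j) + arc (j, i)],
   which is at most 1. *)
rewrite big_split /= [X in _ + X]exchange_big -big_split -sum1_card /=.
apply: leq_sum => i _; rewrite -big_split (leq_trans _ (sum_points c i)) //=.
apply: leq_sum => j _; rewrite -mulnDl -[leqRHS]mul1n leq_mul2r; apply/orP; right.
by rewrite /arc /=; case: ltgtP; rewrite ?andbF ?andbT ?addn0 ?leq_b1.
Qed.

Lemma edge_pot_le c i j : edge_pot c i j <= 2 + (points c i j + points c j i).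
Proof.
by rewrite /edge_pot; case: (points c i j) (points c j i) => -[] /=;
  do ?case: ifP.
Qed.

Lemma potential_le c : potential c <= 3 * #|V| + 2 * #|edges adj|.
Proof.
(* Two per process for Update moves, one for its pointer in [c]. *)
rewrite (_ : 3 = 2 + 1) // mulnDl -addnA mul1n leq_add //.
  rewrite mulnC -sum_nat_const; apply: leq_sum => i _.
  by rewrite /update_pot; do ?case: ifP.
apply: (@leq_trans (\sum_(e | arc e)
    (2 + (points c e.1 e.2 + points c e.2 e.1)))).
  by apply: leq_sum => e _; apply: edge_pot_le.
rewrite big_split addnC leq_add ?sum_arc_points //=.
by rewrite sum_nat_const mulnC leq_mul2l card_arc.
Qed.

(** * Effect of one step on the potential *)

Section Step.
Variables c c' : config.
Hypothesis cc' : step ident c c'.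

Lemma step_local i :
  (mvar c' i = mvar c i /\ pvar c' i = pvar c i) \/
  move ident c i (mvar c' i) (pvar c' i).
Proof.
case: cc' => S [_ _ mv st]; case: (boolP (i \in S)) => [/mv|/st]; by [right|left].
Qed.

Lemma step_mvar i : mvar c' i = mvar c i \/ mvar c' i = PRmarried c i.
Proof. by case: (step_local i) => [[-> _]|]; [left|case; auto]. Qed.

(** Only Marriage and Seduction set a pointer; both need it null, so [i] is unmarried and the guard
    makes [mvar c i] false. *)
Lemma step_points_gain i j : ~~ points c i j -> points c' i j ->
  [/\ pvar c i = None, mvar c i = false, mvar c' i = false &
      points c j i \/
      [/\ pvar c j = None, (ident i < ident j)%O & mvar c j = false]].
Proof.
rewrite /points => /negP npi pi'; case: (step_local i) => [[_ eqp]|mv].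
  by rewrite eqp in pi'.
case: mv pi' => [_ /npi //|k|k|//] /and3P[/eqP mi /eqP pi _].
  case/andP=> _ pk /eqP[<-]; rewrite mi PRmarried_None //.
  by split=> //; left.
case/and4P=> _ /eqP pk ltik /eqP mk _ /eqP[<-]; rewrite mi PRmarried_None //.
by split=> //; right.
Qed.

(** Only Abandonment drops a pointer, and only one that is not returned, so again the guard makes
    [mvar c i] false. *)
Lemma step_points_loss i j : points c i j -> ~~ points c' i j ->
  [/\ pvar c' i = None, ~~ points c j i, mvar c i = false, mvar c' i = false &
      mvar c j || (ident j <= ident i)%O].
Proof.
rewrite /points => /eqP pi npi'; case: (step_local i) => [[_ eqp]|mv].
  by rewrite eqp pi eqxx in npi'.
case: mv npi' => [_|k /and3P[_]|k /and3P[_]|]; rewrite ?pi ?eqxx //.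
case/andP=> /eqP mi; rewrite pi => /andP[npj mj] _.
by rewrite mi (PRmarried_Some pi) (negbTE npj); split.
Qed.

Lemma step_married i j : points c i j -> points c j i -> points c' i j.
Proof.
by move=> pij pji; apply/negPn/negP => /(step_points_loss pij)[_]; rewrite pji.
Qed.

Lemma step_PRmarried i : PRmarried c i -> PRmarried c' i.
Proof.
case/PRmarriedP=> j /eqP pi /eqP pj; apply/PRmarriedP; exists j.
  exact/eqP/step_married.
exact/eqP/step_married.
Qed.

Lemma step_update_pot i :
  update_pot c' i + (mvar c' i != mvar c i) <= update_pot c i.
Proof.
rewrite /update_pot; have := @step_PRmarried i; case: (step_mvar i) => ->;
  by case: (mvar c i) (PRmarried c i) (PRmarried c' i) => -[] [] // /(_ isT).
Qed.

(** Two simultaneous pointer changes count once. Value 3 pays for an abandonment and then a fresh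
    courtship worth 2; value 1 pays for an answer by [j], or for [i] leaving once [j] is married
    elsewhere. *)
Lemma step_edge_pot i j : (ident i < ident j)%O ->
  edge_pot c' i j + ((points c' i j != points c i j) ||
                     (points c' j i != points c j i)) <= edge_pot c i j.
Proof.
move=> ltij.
have leij : (ident j <= ident i)%O = false by rewrite leNgt ltij.
have ltji : (ident j < ident i)%O = false.
  by apply/negbTE; rewrite -leNgt ltW.
have gi := @step_points_gain i j; have gj := @step_points_gain j i.
have li := @step_points_loss i j; have lj := @step_points_loss j i.
have mij := @step_married i j; have mji := @step_married j i.
have pm := @step_PRmarried j; have um := step_mvar j.
rewrite leij orbF in li; rewrite ltji in gj.
rewrite /edge_pot.
(* No process becomes wrongly [true]: Update copies the truth in [c], and marriages persist. *)
have {}um : mvar c' j -> ~~ PRmarried c' j -> mvar c j && ~~ PRmarried c j.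
  case: um => -> mj /(contra pm) nm; first by rewrite mj nm.
  by rewrite mj in nm.
case: (points c i j) gi li gj lj mij mji => gi li gj lj mij mji;
case: (points c j i) gi li gj lj mij mji => gi li gj lj mij mji.
- by rewrite mij ?mji.
- case: (points c' i j) li mij mji {gi} => li mij mji;
  case: (points c' j i) gj {lj} => gj //=.
  + by case: ifP.
  + case: ifP um => [/andP[-> ->] /(_ isT isT) -> //|_ _]; by case: ifP.
  (* [i] leaves only if [mvar c j] is true, [j] joins only if it is false. *)
  + by have [_ _ _ _ mj] := li isT isT; have [] := gj isT isT; rewrite mj.
  (* [i] abandons [j]: the value drops from 1 to 0 if [j] is married, otherwise from 3 to at most
     2. *)
  + have [_ _ _ _ mj] := li isT isT; rewrite mj /=.
    case mar: (PRmarried c j) => /=; last by case: ifP.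
    rewrite pm //; case: (step_mvar j) => ->; by rewrite ?mj ?mar.
- case: (points c' i j) gi {li mij mji} => gi;
  case: (points c' j i) lj {gj} => lj //=; try by case: ifP.
  (* [j] leaves as [i] turns to it: [mvar c' j] is false, so the new value is 1. *)
  by have [_ _ _ -> _] := lj isT isT.
- case: (points c' i j) gi {li mij mji} => gi;
  case: (points c' j i) gj {lj} => gj //=.
  (* The larger endpoint [j] cannot seduce [i], and Marriage needs [i] to point to [j] already. *)
  + by have [_ _ _ []//[]] := gj isT isT.
  + have [_ _ _ []//[pj _ mj]] := gi isT isT.
    rewrite mj /=; case: ifP => // /andP[mj' nm'].
    by have := um mj' nm'; rewrite mj.
  + by have [_ _ _ []//[]] := gj isT isT.
  + case mj: (mvar c j); case mar: (PRmarried c j) => /=; try by case: ifP.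
    rewrite pm //; case: (step_mvar j) => ->; by rewrite ?mj ?mar.
Qed.

Lemma step_potential : potential c' < potential c.
Proof.
have leU i : update_pot c' i <= update_pot c i.
  exact: leq_trans (leq_addr _ _) (step_update_pot i).
have leE e : arc e -> edge_pot c' e.1 e.2 <= edge_pot c e.1 e.2.
  by case/andP=> _ /step_edge_pot; apply: leq_trans (leq_addr _ _).
have ltE i j : adj i j -> points c' i j != points c i j ->
    potential c' < potential c.
  move=> ij ch; rewrite /potential -addnS leq_add ?leq_sum //.
  have := adj_ident_neq ij; rewrite neq_lt => /orP[] lt.
    apply: (@ltn_sum_D1 _ _ _ _ (i, j)) => //; first by rewrite /arc ij.
    by have := step_edge_pot lt; rewrite ch addn1.
  apply: (@ltn_sum_D1 _ _ _ _ (j, i)) => //; first by rewrite /arc /= adjS ij.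
  by have := step_edge_pot lt; rewrite ch orbT addn1.
have ltU i : mvar c' i != mvar c i -> potential c' < potential c.
  move=> ch; rewrite /potential -addSn leq_add ?leq_sum //.
  apply: (@ltn_sum_D1 _ _ _ _ i) => //.
  by have := step_update_pot i; rewrite ch addn1.
(* One mover suffices: Update changes its [mvar], any other rule a pointer along an edge. *)
case: cc' => S [/set0Pn[i iS] _ /(_ i iS) mv _].
move e1: (mvar c' i) mv => b; move e2: (pvar c' i) => q mv.
case: mv e1 e2 => [ug|j g cand|j g cand _|g] e1 e2.
- by apply: (ltU i); rewrite e1 eq_sym.
- apply: (ltE i j); first by case/andP: cand.
  by case/and3P: g => _ /eqP pi _; rewrite /points pi e2 eqxx.
- apply: (ltE i j); first by case/and4P: cand.
  by case/and4P: g => _ /eqP pi _ _; rewrite /points pi e2 eqxx.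
- case/andP: g => _; case pi: (pvar c i) => [j|] // _.
  by apply: (ltE i j); rewrite ?(pvar_adj pi) // /points pi e2 eqxx.
Qed.

End Step.

(** * Terminal configurations and executions *)

Lemma move_adj c i b q j : move ident c i b q -> q = Some j -> adj i j.
Proof.
case=> [_|k _ /andP[ik _]|k _ /and4P[ik _ _ _] _|//]; first exact: pvar_adj.
  by case=> <-.
by case=> <-.
Qed.

(** The daemon may select [i] alone. *)
Lemma move_step c i b q : eligible ident c i -> move ident c i b q ->
  exists c', step ident c c'.
Proof.
move=> el mv.
pose p' k := if k == i then q else pvar c k.
have p'_adj k j : p' k = Some j -> adj k j.
  rewrite /p'; case: eqP => [->|_]; [exact: move_adj mv | exact: pvar_adj].
exists (Config (fun k => if k == i then b else mvar c k) p'_adj), [set i].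
split=> [|k|k|k]; rewrite ?inE.
- by apply/set0Pn; exists i; rewrite inE.
- by move/eqP->.
- by move/eqP->; rewrite /= /p' eqxx.
- by move/negbTE=> nki; rewrite /= /p' nki.
Qed.

Lemma eligible_move c i : eligible ident c i -> exists b q, move ident c i b q.
Proof.
case/or4P=> g.
- by do 2 eexists; apply: MoveUpdate.
- case/and3P: (g) => _ _ /existsP[j cand].
  by do 2 eexists; apply: MoveMarriage g cand.
- case/and4P: (g) => _ _ _ /existsP[j0 cand0].
  have [j cand jmax] := @arg_maxP _ _ _ j0 (seduction_cand ident c i) ident cand0.
  by do 2 eexists; apply: MoveSeduction g cand jmax.
- by do 2 eexists; apply: MoveAbandonment.
Qed.

Lemma terminal_stable c : (forall c', ~ step ident c c') -> stable ident c.
Proof.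
move=> term; apply/forallP => i; apply/negP => el.
have [b [q mv]] := eligible_move el.
by have [c' /term] := move_step el mv.
Qed.

(** Strong induction on the potential, applied to the tail of the execution; where the sequence
    ends, maximality gives stability. *)
Lemma execution_stable x c : execution ident x -> x 0 = Some c ->
  exists k c', [/\ k <= potential c, x k = Some c' & stable ident c'].
Proof.
have [n le_n] := ubnP (potential c).
elim: n x c le_n => // n IHn x c le_n [_ xN xS] x0.
have := xS 0 c x0; case x1: (x 1) => [c'|] st; last first.
  by exists 0, c; split=> //; exact: terminal_stable.
have lt_c' := step_potential st.
have ex' : execution ident (fun k => x k.+1).
  by split=> [|k /xN|k b /xS] //; rewrite x1.
have [k [b [lek xk sb]]] := IHn _ _ (leq_trans lt_c' le_n) ex' x1.
by exists k.+1, b; split=> //; apply: leq_ltn_trans lek lt_c'.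
Qed.

End Potential.

Theorem theorem2 (V : finType) (adj : rel V) (d : Order.disp_t)
    (I : orderType d) (ident : V -> I) (x : nat -> option (config adj)) :
  simple_graph adj ->
  locally_distinct adj ident ->
  execution ident x ->
  exists k c,
    [/\ (k <= 3 * #|V| + 2 * #|edges adj|)%N, x k = Some c & stable ident c].
Proof.
move=> [adjS adjI] dist ex; case x0: (x 0) => [c|]; last by case: ex; rewrite x0.
have [k [c' [lek xk sc']]] := execution_stable adjS adjI dist ex x0.
exists k, c'; split=> //; apply: leq_trans lek _.
exact: potential_le.
Qed.
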